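(* Let $\hat{\mu}_i^{mle}$ denote the maximum likelihood estimator of $\mu_i$ in the normal one-way layout under the order restriction $H=\{(\mu_0,\mu_1,\dots,\mu_k):\mu_1\le\cdots\le\mu_k\}$, and let $\hat{\mu}_i$ be the SDMMSA estimator computed from $\{(\bar{Y}_i,n_i)\}_{i=1}^k$. Then $\hat{\mu}_i=\hat{\mu}_i^{mle}$ for all $i\in[1,k]$.
   Context: Integer intervals: $[a,b]$ denotes the set of integers from $a$ to $b$. Model: $Y_{ij}=\mu_i+\varepsilon_{ij}$ for $i=0,\dots,k$, $j=1,\dots,n_i$, where the $\mu_i$ are unknown real means and the $\varepsilon_{ij}\sim N(0,\sigma^2)$ are independent with unknown variance $\sigma^2$. The parameter space is $H$ (with $\sigma>0$ also unknown; $\mu_0$ is unrestricted). $\bar{Y}_i$ is the sample mean of $Y_{i1},\dots,Y_{in_i}$. For $1\le i\le j\le k$ put $n_{i,j}=\sum_{h=i}^j n_h$ and $\bar{Y}_{i,j}=\frac{1}{n_{i,j}}\sum_{h=i}^j n_h\bar{Y}_h$. SDMMSA (step-down maximum mean selection algorithm): set $i_0=k+1$. Given $i_{u-1}>1$, let $i_u$ be the smallest $j\in[1,i_{u-1}-1]$ such that $\bar{Y}_{j,i_{u-1}-1}=\max_{1\le j'\le i_{u-1}-1}\bar{Y}_{j',i_{u-1}-1}$, and define $\hat{\mu}_i=\bar{Y}_{i_u,i_{u-1}-1}$ for all $i\in[i_u,i_{u-1}-1]$. Stop at the first $u=h$ with $i_h=1$. This defines $\hat{\mu}_i$ for every $i\in[1,k]$.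 *)

(* Defs.v *)
From mathcomp Require Import all_boot all_order all_algebra.
From mathcomp Require Import all_classical all_reals all_analysis.

Set Implicit Arguments.
Unset Strict Implicit.
Unset Printing Implicit Defensive.

Import Order.TTheory GRing.Theory Num.Theory.

Local Open Scope ring_scope.

(* Populations are indexed by 'I_k.+1, i.e. by 0, ..., k.  The observations of
   population i are indexed by 'I_(n i), i.e. by 0, ..., n i - 1 instead of
   1, ..., n i. *)

Section OneWayLayout.
Variables (R : realType) (k : nat) (n : 'I_k.+1 -> nat).
Variable y : forall i : 'I_k.+1, 'I_(n i) -> R.

Definition sample_mean (i : 'I_k.+1) : R :=
  (\sum_(j < n i) y j) / (n i)%:R.

(* The joint density, at the data y, of independent Y_ij ~ N(mu_i, sigma^2);
   the second parameter of normal_pdf is the standard deviation. *)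
Definition likelihood (mu : 'I_k.+1 -> R) (sigma : R) : R :=
  \prod_(i < k.+1) \prod_(j < n i) normal_pdf (mu i) sigma (y j).

(* mu_1 <= ... <= mu_k, with mu_0 unrestricted. *)
Definition order_restricted (mu : 'I_k.+1 -> R) : Prop :=
  forall i j : 'I_k.+1, (1 <= i)%N -> (i <= j)%N -> mu i <= mu j.

Definition is_mle (mu : 'I_k.+1 -> R) (sigma : R) : Prop :=
  [/\ order_restricted mu, 0 < sigma
    & forall (mu' : 'I_k.+1 -> R) (sigma' : R),
        order_restricted mu' -> 0 < sigma' ->
        likelihood mu' sigma' <= likelihood mu sigma].

(* Some admissible mean vector reproduces the data with zero residuals.  The
   likelihood is then unbounded as sigma tends to 0, so no maximum likelihood
   estimate exists. *)
Definition exact_fit : Prop :=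
  exists2 mu : 'I_k.+1 -> R, order_restricted mu &
    forall (i : 'I_k.+1) (j : 'I_(n i)), y j = mu i.

End OneWayLayout.

Section StepDownMaximumMeanSelection.
Variables (R : realFieldType) (k : nat) (n : 'I_k.+1 -> nat).
Variable ybar : 'I_k.+1 -> R.

Definition pooled_size (a b : nat) : nat :=
  (\sum_(h < k.+1 | a <= h <= b) n h)%N.

Definition pooled_mean (a b : nat) : R :=
  (\sum_(h < k.+1 | (a <= h <= b)%N) (n h)%:R * ybar h) / (pooled_size a b)%:R.

(* The smallest j in [1, m] at which pooled_mean j m is maximal over [1, m]
   (the default value of head is only used for m = 0). *)
Definition max_mean_start (m : nat) : nat :=
  head 1%N [seq j <- iota 1 m |
             all (fun j' => pooled_mean j' m <= pooled_mean j m) (iota 1 m)].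

(* i_0 = k + 1, i_1, i_2, ...; once the value 1 is reached the sequence is
   stationary, which encodes stopping. *)
Definition sdmmsa_cut (u : nat) : nat :=
  iter u (fun p => if (1 < p)%N then max_mean_start p.-1 else p) k.+1.

(* The cuts strictly decrease until they reach 1, hence, for i in [1, k], the
   first u with i_u <= i is at most k, and it is the step whose block
   [i_u, i_(u-1) - 1] contains i. *)
Definition sdmmsa_step (i : nat) : nat :=
  find (fun u => (sdmmsa_cut u <= i)%N) (iota 0 k.+1).

Definition sdmmsa (i : nat) : R :=
  let u := sdmmsa_step i in
  pooled_mean (sdmmsa_cut u) (sdmmsa_cut u.-1).-1.

End StepDownMaximumMeanSelection.

(* Main.v *)
Require Import Defs.
From mathcomp Require Import all_boot all_order all_algebra.
From mathcomp Require Import all_classical all_reals all_analysis.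
From mathcomp Require Import ring lra zify.

Import Order.TTheory GRing.Theory Num.Theory.

Local Open Scope ring_scope.

(** The likelihood depends on the mean vector only through the residual sum of
squares [rss], and for fixed sigma it decreases strictly in it.  Hence a
maximum likelihood estimate of the means is a least squares fit among the
admissible mean vectors, i.e. the projection of the sample means onto the
closed convex cone of vectors with mu_1 <= ... <= mu_k, in the inner product
weighted by the sample sizes.

The step-down algorithm computes that projection.  Let f be the vector that it
produces, completed by the sample mean of population 0 ([sdmmsa_fit]).  The
projection is characterised by two facts: f lies in the cone
([sdmmsa_fit_restricted]), and the angle at f between the sample means and any
z of the cone is obtuse, that is, the weighted inner product of ybar - f and
f - z is nonnegative ([sdmmsa_fit_obtuse]).  Both come from the choice of a cut
as a maximiser of the mean of a tail.
- Since the mean over [j, b) is at most the mean c over the whole block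
  [a, b), for all j, every tail sum of the weighted deviations
  w_h (ybar_h - c) over a block is nonpositive, while the total is zero.
  Summation by parts against a nondecreasing z makes the sum of
  w_h (ybar_h - c) z_h nonpositive ([block_obtuse]); the blocks add up.
- The maximiser also beats the union of its block with the next lower one,
  and that union averages the two blocks; so the lower block has the smaller
  mean ([weighted_mean_cat_le]), and f is nondecreasing.

Expanding squares around f then gives
rss z >= rss f + sum_i n_i (f_i - z_i)^2 on the cone ([rss_sdmmsa_fit]).
If (mu, sigma) is a maximum likelihood estimate, comparison with (f, sigma)
yields rss mu <= rss f, and therefore mu = f.  For the existence, the absence
of an exact fit means rss f > 0, and (f, s) with s^2 = rss f / N is then a
maximiser by [profile_likelihood_le]. *)

(** * Weighted means over integer intervals *)

Definition weighted_mean {R : realFieldType} (w x : nat -> R) (a b : nat) : R :=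
  (\sum_(a <= h < b) w h * x h) / (\sum_(a <= h < b) w h).

Lemma sumr_nat_gt0 {R : realFieldType} (w : nat -> R) (a b : nat) :
  (forall i, 0 < w i) -> (a < b)%N -> 0 < \sum_(a <= h < b) w h.
Proof.
move=> w_gt0 ab; rewrite big_ltn// ltr_wpDr//.
by apply: sumr_ge0 => i _; exact: ltW.
Qed.

Lemma sum_centered {R : realFieldType} (w x : nat -> R) (a b : nat) (c : R) :
  (forall i, 0 < w i) -> (a < b)%N ->
  \sum_(a <= h < b) w h * (x h - c) =
  (\sum_(a <= h < b) w h) * (weighted_mean w x a b - c).
Proof.
move=> w_gt0 ab; rewrite mulrBr mulrC /weighted_mean divfK; last first.
  by rewrite gt_eqF// sumr_nat_gt0.
by rewrite mulr_suml -sumrB; apply: eq_bigr => i _; rewrite mulrBr.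
Qed.

Lemma weighted_mean_le {R : realFieldType} (w x : nat -> R) (a b : nat) (c : R) :
  (forall i, 0 < w i) -> (a < b)%N ->
  (weighted_mean w x a b <= c) = (\sum_(a <= h < b) w h * (x h - c) <= 0).
Proof.
by move=> w_gt0 ab; rewrite sum_centered// pmulr_rle0 ?sumr_nat_gt0// subr_le0.
Qed.

Lemma sum_centered0 {R : realFieldType} (w x : nat -> R) (a b : nat) :
  (forall i, 0 < w i) -> (a < b)%N ->
  \sum_(a <= h < b) w h * (x h - weighted_mean w x a b) = 0.
Proof. by move=> w_gt0 ab; rewrite sum_centered// subrr mulr0. Qed.

(** The mean over [a, c) is an average of the means over [a, b) and [b, c), so
it can be at most the latter only if the former is. *)
Lemma weighted_mean_cat_le {R : realFieldType} (w x : nat -> R) (a b c : nat) :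
  (forall i, 0 < w i) -> (a < b)%N -> (b < c)%N ->
  weighted_mean w x a c <= weighted_mean w x b c ->
  weighted_mean w x a b <= weighted_mean w x b c.
Proof.
move=> w_gt0 ab bc; rewrite !weighted_mean_le//; last exact: ltn_trans bc.
by rewrite (big_cat_nat (ltnW ab) (ltnW bc))/= sum_centered0// addr0.
Qed.

(** Summation by parts: with T_j the sum of f over [j, b), the left-hand side is
z_a T_a plus the sum over j > a of T_j (z_j - z_(j-1)), whose terms are
nonpositive.  The induction peels off the first index. *)
Lemma abel_sum_le {R : realFieldType} (f z : nat -> R) (a b : nat) :
  (a < b)%N ->
  (forall j, (a <= j < b)%N -> \sum_(j <= h < b) f h <= 0) ->
  (forall j, (a <= j)%N -> (j.+1 < b)%N -> z j <= z j.+1) ->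
  \sum_(a <= h < b) f h * z h <= z a * \sum_(a <= h < b) f h.
Proof.
move=> ab; have [d ->] : exists d, b = (a + d.+1)%N by exists (b - a.+1)%N; lia.
elim: d a {b ab} => [|d IH] a tail_le0 z_mono.
  by rewrite addn1 !big_nat1 mulrC.
have a_lt : (a < a + d.+2)%N by lia.
rewrite !(big_ltn a_lt) mulrDr [z a * f a]mulrC lerD2l.
have -> : (a + d.+2 = a.+1 + d.+1)%N by lia.
apply: (le_trans (IH _ _ _)) => [j jab|j ja jb|].
- have -> : (a.+1 + d.+1 = a + d.+2)%N by lia.
  by apply: tail_le0; lia.
- by apply: z_mono; lia.
- apply: ler_wnM2r; last by apply: z_mono; lia.
  have := tail_le0 a.+1; rewrite addSnnS; apply; lia.
Qed.

(** The deviations from the mean sum to zero, so the constant factor c of c - z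
contributes nothing; the maximality of the mean among the tails of the block
is what makes the tail sums of the deviations nonpositive. *)
Lemma block_obtuse {R : realFieldType} (w x z : nat -> R) (a b : nat) :
  (forall i, 0 < w i) -> (a < b)%N ->
  (forall j, (a <= j < b)%N -> weighted_mean w x j b <= weighted_mean w x a b) ->
  (forall j, (a <= j)%N -> (j.+1 < b)%N -> z j <= z j.+1) ->
  0 <= \sum_(a <= h < b)
         w h * (x h - weighted_mean w x a b) * (weighted_mean w x a b - z h).
Proof.
set c := weighted_mean w x a b => w_gt0 ab c_max z_mono.
have tot0 := sum_centered0 w x a b w_gt0 ab; rewrite -/c in tot0.
under eq_bigr do rewrite mulrBr.
rewrite sumrB -mulr_suml tot0 mul0r sub0r oppr_ge0.
rewrite -[leRHS](mulr0 (z a)) -[in leRHS]tot0; apply: abel_sum_le => // j jab.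
by rewrite -weighted_mean_le//; [exact: c_max | case/andP: jab].
Qed.

(** * The blocks of the step-down algorithm *)

Lemma sum_ord_interval {V : nmodType} {k : nat} (F : 'I_k.+1 -> V) (a b : nat) :
  (b <= k)%N ->
  \sum_(h < k.+1 | (a <= h <= b)%N) F h = \sum_(a <= h < b.+1) F (inord h).
Proof.
move=> bk; rewrite (big_nat_widen a b.+1 k.+1)// big_geq_mkord.
by apply: eq_big => [h|h _]; rewrite ?inord_val// ltnS andbC.
Qed.

(** The mean over the half-open block [a, b): blocks are delimited by consecutive
cuts, so that adjacent ones concatenate without shifts.  The populations are
read through [inord], whose default value is not met as long as b <= k.+1. *)
Definition block_mean {R : realFieldType} {k : nat} (n : 'I_k.+1 -> nat)
    (ybar : 'I_k.+1 -> R) (a b : nat) : R :=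
  weighted_mean (fun h => (n (inord h))%:R) (fun h => ybar (inord h)) a b.

Lemma pooled_meanE {R : realFieldType} {k : nat} (n : 'I_k.+1 -> nat)
    (ybar : 'I_k.+1 -> R) (a b : nat) :
  (b <= k)%N ->
  pooled_mean n ybar a b = block_mean n ybar a b.+1.
Proof.
move=> bk; rewrite /pooled_mean /pooled_size /block_mean /weighted_mean.
by rewrite natr_sum !sum_ord_interval.
Qed.

Lemma max_mean_startP {R : realFieldType} {k : nat} (n : 'I_k.+1 -> nat)
    (ybar : 'I_k.+1 -> R) (m : nat) (s := max_mean_start n ybar m) :
  (0 < m)%N ->
  (1 <= s <= m)%N /\
  forall j, (1 <= j <= m)%N -> pooled_mean n ybar j m <= pooled_mean n ybar s m.
Proof.
move=> m_gt0; rewrite {}/s /max_mean_start.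
set c := seq.filter _ _.
(* The head of the list is a maximiser, and not the default, once the list of
   maximisers is known to be nonempty. *)
suff s_in : head 1%N c \in c.
  move: s_in; rewrite mem_filter => /andP[/allP s_max]; rewrite mem_iota add1n ltnS.
  by move=> s_rng; split=> // j jm; apply: s_max; rewrite mem_iota add1n ltnS.
suff [j] : exists j, j \in c by case: (c) => // a l _; rewrite mem_head.
have [j _ j_max] := @arg_maxP _ R 'I_m (Ordinal m_gt0) predT
  (fun j => pooled_mean n ybar j.+1 m) isT.
exists j.+1; rewrite mem_filter mem_iota; apply/andP; split; last by have := ltn_ord j; lia.
apply/allP => -[|i]; rewrite mem_iota// => i_rng; have im : (i < m)%N by lia.
exact: (j_max (Ordinal im) isT).
Qed.

(** Each step lowers the cut by at least one until it reaches 1; the upper bound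
shows that it has done so after k steps. *)
Lemma sdmmsa_cut_range {R : realFieldType} {k : nat} (n : 'I_k.+1 -> nat)
    (ybar : 'I_k.+1 -> R) (u : nat) :
  (1 <= sdmmsa_cut n ybar u <= (k - u).+1)%N.
Proof.
elim: u => [|u IH]; first by rewrite /sdmmsa_cut /= subn0 ltnSn.
rewrite /sdmmsa_cut iterS -/(sdmmsa_cut n ybar u).
case: ifP => cut_gt1; last by lia.
have /(max_mean_startP n ybar)[+ _] : (0 < (sdmmsa_cut n ybar u).-1)%N by lia.
by lia.
Qed.

Lemma sdmmsa_cutP {R : realFieldType} {k : nat} (n : 'I_k.+1 -> nat)
    (ybar : 'I_k.+1 -> R) (u : nat)
    (a := sdmmsa_cut n ybar u.+1) (b := sdmmsa_cut n ybar u) :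
  (1 < b)%N ->
  (1 <= a < b)%N /\
  forall j, (1 <= j < b)%N ->
    block_mean n ybar j b <= block_mean n ybar a b.
Proof.
move=> b_gt1.
have aE : a = max_mean_start n ybar b.-1.
  by rewrite {}/a /sdmmsa_cut iterS -/(sdmmsa_cut n ybar u) -/b b_gt1.
have b_range : (1 <= b <= (k - u).+1)%N := sdmmsa_cut_range n ybar u.
have /(max_mean_startP n ybar) : (0 < b.-1)%N by lia.
rewrite -aE => -[a_range a_max]; split=> [|j jb]; first by lia.
have bE : b = b.-1.+1 by lia.
rewrite bE -!pooled_meanE; [|lia..].
by apply: a_max; lia.
Qed.

Lemma sdmmsa_cut_le {R : realFieldType} {k : nat} (n : 'I_k.+1 -> nat)
    (ybar : 'I_k.+1 -> R) (u v : nat) :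
  (u <= v)%N -> (sdmmsa_cut n ybar v <= sdmmsa_cut n ybar u)%N.
Proof.
move=> uv; rewrite -(subnK uv); elim: (v - u)%N => // d IH.
rewrite addSn; apply: leq_trans IH.
have := sdmmsa_cut_range n ybar (d + u); case: (ltnP 1 (sdmmsa_cut n ybar (d + u))).
  by move=> /sdmmsa_cutP[+ _]; lia.
by rewrite [sdmmsa_cut n ybar (d + u).+1]/sdmmsa_cut iterS -/(sdmmsa_cut n ybar (d + u));
  move=> /leq_gtF ->.
Qed.

Lemma sdmmsa_blockE {R : realFieldType} {k : nat} (n : 'I_k.+1 -> nat)
    (ybar : 'I_k.+1 -> R) (u i : nat)
    (a := sdmmsa_cut n ybar u.+1) (b := sdmmsa_cut n ybar u) :
  (a <= i < b)%N ->
  sdmmsa n ybar i = block_mean n ybar a b.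
Proof.
move=> iab.
have a_range : (1 <= a <= (k - u.+1).+1)%N := sdmmsa_cut_range n ybar u.+1.
have b_range : (1 <= b <= (k - u).+1)%N := sdmmsa_cut_range n ybar u.
rewrite /sdmmsa.
have -> : sdmmsa_step n ybar i = u.+1.
  rewrite /sdmmsa_step; set p := fun v => _.
  have pu : p u.+1 by rewrite /p -/a; lia.
  have u_in : u.+1 \in iota 0 k.+1 by rewrite mem_iota; lia.
  have p_has : has p (iota 0 k.+1) by apply/hasP; exists u.+1.
  case: (ltngtP (find p (iota 0 k.+1)) u.+1) => // find_u.
  - have := nth_find 0%N p_has; rewrite nth_iota ?add0n; last first.
      by move: p_has; rewrite has_find size_iota.
    move=> find_le; have {}find_le : (sdmmsa_cut n ybar (find p (iota 0 k.+1)) <= i)%N.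
      exact: find_le.
    have := sdmmsa_cut_le n ybar (find p (iota 0 k.+1)) u find_u; rewrite -/b; lia.
  - have := before_find 0%N find_u; rewrite nth_iota ?add0n ?pu//; lia.
rewrite /= -/a -/b pooled_meanE; last by lia.
by rewrite prednK//; lia.
Qed.

Lemma sdmmsa_block_of {R : realFieldType} {k : nat} (n : 'I_k.+1 -> nat)
    (ybar : 'I_k.+1 -> R) (i : nat) :
  (1 <= i <= k)%N ->
  exists u, (sdmmsa_cut n ybar u.+1 <= i < sdmmsa_cut n ybar u)%N.
Proof.
move=> ik.
have ex_u : exists u, (sdmmsa_cut n ybar u <= i)%N.
  by exists k; have := sdmmsa_cut_range n ybar k; lia.
case: (ex_minnP ex_u) => -[|u] ui u_min.
  by move: ui; rewrite /sdmmsa_cut /=; lia.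
by exists u; rewrite ui ltnNge /=; apply/negP => /u_min; lia.
Qed.

(** Neighbours differ in value only across a cut a.  The maximality of the block
mean over [a, b) is then applied to the start a' of the next lower block, that
is, to the union of the two blocks. *)
Lemma sdmmsa_isotone {R : realFieldType} {k : nat} (n : 'I_k.+1 -> nat)
    (ybar : 'I_k.+1 -> R) (i : nat) :
  (forall h, (0 < n h)%N) ->
  (1 <= i)%N -> (i.+1 <= k)%N -> sdmmsa n ybar i <= sdmmsa n ybar i.+1.
Proof.
move=> n_gt0 i_ge1 ik.
have w_gt0 h : 0 < (n (inord h))%:R :> R by rewrite ltr0n.
have /(sdmmsa_block_of n ybar)[u] : (1 <= i.+1 <= k)%N by lia.
set a := sdmmsa_cut _ _ u.+1; set b := sdmmsa_cut _ _ u => iab.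
rewrite (sdmmsa_blockE _ _ u i.+1)// -/a -/b.
have [ai|ia] := leqP a i; first by rewrite (sdmmsa_blockE _ _ u i)//; lia.
have aE : a = i.+1 by lia.
have /sdmmsa_cutP : (1 < a)%N by lia.
rewrite -/a; set a' := sdmmsa_cut _ _ u.+2 => -[a'_range _].
rewrite (sdmmsa_blockE _ _ u.+1 i) -/a -/a'; last by lia.
have /sdmmsa_cutP[_ a_max] : (1 < b)%N by lia.
by apply: weighted_mean_cat_le => //; [lia | lia | apply: a_max; rewrite -/b; lia].
Qed.

(** The blocks partition [1, k], and the inequality holds on each of them; the
induction adds one block at a time, from the top downwards. *)
Lemma sdmmsa_obtuse {R : realFieldType} {k : nat} (n : 'I_k.+1 -> nat)
    (ybar : 'I_k.+1 -> R) (z : nat -> R) :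
  (forall h, (0 < n h)%N) ->
  (forall j, (1 <= j)%N -> (j.+1 <= k)%N -> z j <= z j.+1) ->
  0 <= \sum_(1 <= h < k.+1) (n (inord h))%:R *
         (ybar (inord h) - sdmmsa n ybar h) * (sdmmsa n ybar h - z h).
Proof.
move=> n_gt0 z_mono.
have w_gt0 h : 0 < (n (inord h))%:R :> R by rewrite ltr0n.
pose F (h : nat) : R := (n (inord h))%:R *
  (ybar (inord h) - sdmmsa n ybar h) * (sdmmsa n ybar h - z h).
suff tail_ge0 u : 0 <= \sum_(sdmmsa_cut n ybar u <= h < k.+1) F h.
  have := tail_ge0 k; suff -> : sdmmsa_cut n ybar k = 1%N by [].
  by have := sdmmsa_cut_range n ybar k; lia.
elim: u => [|u IH]; first by rewrite /sdmmsa_cut /= big_geq.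
have [b_gt1|b_le1] := ltnP 1 (sdmmsa_cut n ybar u); last first.
  by rewrite /sdmmsa_cut iterS -/(sdmmsa_cut n ybar u) ltnNge b_le1.
have [ab c_max] := sdmmsa_cutP _ _ _ b_gt1; have := sdmmsa_cut_range n ybar u.
have blockE := sdmmsa_blockE n ybar u.
move: ab c_max blockE b_gt1 IH.
set a := sdmmsa_cut _ _ u.+1; set b := sdmmsa_cut _ _ u.
move=> ab c_max blockE b_gt1 IH b_range.
have [ab' bk] : (a <= b)%N /\ (b <= k.+1)%N by lia.
rewrite (big_cat_nat ab' bk)/= addr_ge0//.
rewrite big_nat (eq_bigr (fun h => (n (inord h))%:R *
  (ybar (inord h) - block_mean n ybar a b) * (block_mean n ybar a b - z h))).
  rewrite -big_nat; apply: (block_obtuse (fun h => (n (inord h))%:R)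
    (fun h => ybar (inord h))) => //; first by lia.
  - by move=> j jab; apply: c_max; lia.
  - by move=> j aj jb; apply: z_mono; lia.
by move=> h hab; rewrite /F blockE.
Qed.

(** * Projection onto the order cone *)

Lemma sum_ord_split {V : nmodType} {k : nat} (F : 'I_k.+1 -> V) :
  \sum_(i < k.+1) F i = F ord0 + \sum_(1 <= h < k.+1) F (inord h).
Proof.
under eq_bigr do rewrite -[X in F X]inord_val.
rewrite -(big_mkord predT (fun h => F (inord h))) big_ltn//; congr (F _ + _).
by apply/val_inj; rewrite /= inordK.
Qed.

(** Since mu_0 is unrestricted, population 0 is fitted by its own sample mean. *)
Definition sdmmsa_fit {R : realFieldType} {k : nat} (n : 'I_k.+1 -> nat)
    (ybar : 'I_k.+1 -> R) (i : 'I_k.+1) : R :=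
  if i == ord0 then ybar ord0 else sdmmsa n ybar i.

Lemma sdmmsa_fit_restricted {R : realType} {k : nat} (n : 'I_k.+1 -> nat)
    (ybar : 'I_k.+1 -> R) :
  (forall i, (0 < n i)%N) -> order_restricted (sdmmsa_fit n ybar).
Proof.
move=> n_gt0 i j i_ge1 ij.
have neq0 (h : 'I_k.+1) : (1 <= h)%N -> h == ord0 = false.
  by move=> h_ge1; rewrite -val_eqE /= gtn_eqF.
rewrite /sdmmsa_fit !neq0//; last exact: leq_trans ij.
have := ltn_ord j; rewrite -(subnKC ij); elim: (j - i)%N => [|d IH] jk.
  by rewrite addn0.
rewrite addnS in jk *; apply: le_trans (IH _) _; first by lia.
by apply: sdmmsa_isotone => //; lia.
Qed.

(** Population 0 contributes nothing, its fitted value being its sample mean. *)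
Lemma sdmmsa_fit_obtuse {R : realType} {k : nat} (n : 'I_k.+1 -> nat)
    (ybar nu : 'I_k.+1 -> R) (mu := sdmmsa_fit n ybar) :
  (forall i, (0 < n i)%N) -> order_restricted nu ->
  0 <= \sum_(i < k.+1) (n i)%:R * (ybar i - mu i) * (mu i - nu i).
Proof.
move=> n_gt0 nu_restricted; rewrite sum_ord_split.
rewrite {1}/mu /sdmmsa_fit eqxx subrr mulr0 mul0r add0r.
rewrite big_nat (eq_bigr (fun h => (n (inord h))%:R *
  (ybar (inord h) - sdmmsa n ybar h) * (sdmmsa n ybar h - nu (inord h)))).
  rewrite -big_nat; apply: (sdmmsa_obtuse n ybar (fun h => nu (inord h))) => //.
  by move=> j j_ge1 jk; apply: nu_restricted; rewrite !inordK//; lia.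
move=> h /andP[h_ge1 hk].
by rewrite /mu /sdmmsa_fit -val_eqE /= inordK// gtn_eqF.
Qed.

(** * Residual sums of squares *)

Definition rss {R : realType} {k : nat} {n : 'I_k.+1 -> nat}
    (y : forall i : 'I_k.+1, 'I_(n i) -> R) (mu : 'I_k.+1 -> R) : R :=
  \sum_(i < k.+1) \sum_(j < n i) (y i j - mu i) ^+ 2.

(** Within population i the residuals y_ij - mu_i add up to
n_i (ybar_i - mu_i), so the cross term involves the data only through the
sample means. *)
Lemma rssE {R : realType} {k : nat} {n : 'I_k.+1 -> nat}
    (y : forall i : 'I_k.+1, 'I_(n i) -> R) (mu nu : 'I_k.+1 -> R) :
  (forall i, (0 < n i)%N) ->
  rss y nu = rss y mu
    + (\sum_(i < k.+1) (n i)%:R * (sample_mean y i - mu i) * (mu i - nu i)) *+ 2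
    + \sum_(i < k.+1) (n i)%:R * (mu i - nu i) ^+ 2.
Proof.
move=> n_gt0; rewrite -sumrMnl -!big_split; apply: eq_bigr => i _ /=.
have n_neq0 : (n i)%:R != 0 :> R by rewrite pnatr_eq0 -lt0n.
have meanE : \sum_(j < n i) (y i j - mu i) = (n i)%:R * (sample_mean y i - mu i).
  rewrite sumrB sumr_const card_ord mulrBr /sample_mean mulrC divfK//.
  by rewrite mulr_natl.
have constE : \sum_(j < n i) (mu i - nu i) ^+ 2 = (n i)%:R * (mu i - nu i) ^+ 2.
  by rewrite sumr_const card_ord mulr_natl.
rewrite -meanE -constE mulr_suml -sumrMnl -!big_split; apply: eq_bigr => j _ /=.
ring.
Qed.

(** A Pythagorean inequality for the projection onto a convex cone.  The extra
squared distance is what makes the least squares fit unique. *)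
Lemma rss_sdmmsa_fit {R : realType} {k : nat} (n : 'I_k.+1 -> nat)
    (y : forall i : 'I_k.+1, 'I_(n i) -> R) (nu : 'I_k.+1 -> R)
    (mu := sdmmsa_fit n (sample_mean y)) :
  (forall i, (0 < n i)%N) -> order_restricted nu ->
  rss y mu + \sum_(i < k.+1) (n i)%:R * (mu i - nu i) ^+ 2 <= rss y nu.
Proof.
move=> n_gt0 nu_restricted; rewrite (rssE y mu nu)// lerD2r lerDl pmulrn_lge0//.
exact: sdmmsa_fit_obtuse.
Qed.

(** * The normal likelihood *)

Lemma likelihoodE {R : realType} {k : nat} {n : 'I_k.+1 -> nat}
    (y : forall i : 'I_k.+1, 'I_(n i) -> R) (mu : 'I_k.+1 -> R) (sigma : R) :
  0 < sigma ->
  likelihood y mu sigma =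
  normal_peak sigma ^+ (\sum_(i < k.+1) n i) * expR (- rss y mu / (sigma ^+ 2 *+ 2)).
Proof.
move=> sigma_gt0; rewrite /likelihood.
transitivity (\prod_(i < k.+1) (normal_peak sigma ^+ n i *
    expR (\sum_(j < n i) - (y i j - mu i) ^+ 2 / (sigma ^+ 2 *+ 2)))).
  apply: eq_bigr => i _; rewrite expR_sum.
  rewrite -[in X in _ ^+ X](card_ord (n i)) -prodr_const -big_split/=.
  by apply: eq_bigr => j _; rewrite normal_pdfE ?gt_eqF.
rewrite big_split/= prodrXr -expR_sum; congr (_ * expR _).
by rewrite /rss -sumrN mulr_suml; apply: eq_bigr => i _; rewrite -sumrN mulr_suml.
Qed.

Lemma normal_peak_scale {R : realType} (s t : R) :
  0 < s -> 0 < t -> normal_peak t = s / t * normal_peak s.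
Proof.
move=> s_gt0 t_gt0; rewrite /normal_peak -!mulrnAr (sqrtrM _ (sqr_ge0 s)) (sqrtrM _ (sqr_ge0 t)).
rewrite !sqrtr_sqr !gtr0_norm// !invfM mulrA; congr (_ * _).
by rewrite mulrAC divff ?mul1r// gt_eqF.
Qed.

(** t exp(-t^2/2) is maximal at t = 1: this is t <= (1 + t^2)/2 combined with
1 + u <= exp u at u = (t^2 - 1)/2. *)
Lemma mul_expR_half_sqr_le {R : realType} (t : R) :
  t * expR (- (t ^+ 2 / 2)) <= expR (- (1 / 2)).
Proof.
have := expR_ge1Dx ((t ^+ 2 - 1) / 2); set e := expR (_ / _) => e_ge.
have -> : expR (- (1 / 2)) = e * expR (- (t ^+ 2 / 2)).
  by rewrite -expRD; congr expR; field.
rewrite ler_wpM2r ?expR_ge0//; apply: le_trans e_ge.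
by have := sqr_ge0 (t - 1); lra.
Qed.

(** Lowering S' to S only increases the left-hand side.  With S = N s^2, both
sides are N-th powers whose bases, divided by the peak at s, are r exp(-r^2/2)
at r = s / t and at r = 1. *)
Lemma profile_likelihood_le {R : realType} (N : nat) (S S' t : R)
    (s := Num.sqrt (S / N%:R)) :
  (0 < N)%N -> 0 < S -> S <= S' -> 0 < t ->
  normal_peak t ^+ N * expR (- S' / (t ^+ 2 *+ 2)) <=
  normal_peak s ^+ N * expR (- S / (s ^+ 2 *+ 2)).
Proof.
move=> N_gt0 S_gt0 SS' t_gt0.
have NR_gt0 : 0 < N%:R :> R by rewrite ltr0n.
have s2E : s ^+ 2 = S / N%:R by rewrite sqr_sqrtr// divr_ge0// ltW.
have s_gt0 : 0 < s by rewrite sqrtr_gt0 divr_gt0.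
have SE : S = s ^+ 2 * N%:R by rewrite s2E divfK// gt_eqF.
have t_neq0 : t != 0 by rewrite gt_eqF.
have s_neq0 : s != 0 by rewrite gt_eqF.
have peak_ge0 u : 0 <= normal_peak u ^+ N :> R.
  by rewrite exprn_ge0// normal_peak_ge0.
apply: (@le_trans _ _ (normal_peak t ^+ N * expR (- S / (t ^+ 2 *+ 2)))).
  rewrite ler_wpM2l// ler_expR ler_pM2r ?lerN2// invr_gt0 pmulrn_lgt0//.
  exact: exprn_gt0.
have -> : - S / (t ^+ 2 *+ 2) = N%:R * - ((s / t) ^+ 2 / 2).
  by rewrite SE; field.
have -> : - S / (s ^+ 2 *+ 2) = N%:R * - (1 / 2) by rewrite SE; field.
rewrite !expRM_natl -!exprMn.
have pk_ge0 u : 0 <= normal_peak u :> R by exact: normal_peak_ge0.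
rewrite lerXn2r ?nnegrE ?mulr_ge0 ?expR_ge0//.
rewrite (normal_peak_scale s t)// mulrAC mulrC ler_wpM2l//.
exact: mul_expR_half_sqr_le.
Qed.

(** * Maximum likelihood estimates *)

Theorem theorem1 (R : realType) (k : nat) (n : 'I_k.+1 -> nat)
    (n_gt0 : forall i : 'I_k.+1, (0 < n i)%N)
    (y : forall i : 'I_k.+1, 'I_(n i) -> R) :
  (~ exact_fit y -> exists (mu : 'I_k.+1 -> R) (sigma : R), is_mle y mu sigma)
  /\
  (forall (mu : 'I_k.+1 -> R) (sigma : R), is_mle y mu sigma ->
     forall i : 'I_k.+1, (1 <= i)%N ->
       sdmmsa n (sample_mean y) i = mu i).
Proof.
set fit := sdmmsa_fit n (sample_mean y).
have fit_restricted : order_restricted fit by exact: sdmmsa_fit_restricted.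
have dist_ge0 (nu : 'I_k.+1 -> R) i : 0 <= (n i)%:R * (fit i - nu i) ^+ 2.
  by rewrite mulr_ge0// sqr_ge0.
split=> [no_exact_fit | mu sigma [mu_restricted sigma_gt0 mu_max] i i_ge1].
- have N_gt0 : (0 < \sum_(i < k.+1) n i)%N.
    by rewrite (bigD1 ord0)//= ltn_addr.
  have rss_gt0 : 0 < rss y fit.
    have rss_ge0 (i : 'I_k.+1) : 0 <= \sum_(j < n i) (y i j - fit i) ^+ 2.
      by apply: sumr_ge0 => j _; exact: sqr_ge0.
    rewrite lt0r sumr_ge0// andbT; apply/eqP => rss0; apply: no_exact_fit.
    exists fit => // i j.
    have /(_ i isT)/psumr_eq0P := psumr_eq0P (fun i _ => rss_ge0 i) rss0.
    move=> /(_ (fun j _ => sqr_ge0 _) j isT)/eqP.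
    by rewrite sqrf_eq0 subr_eq0 => /eqP.
  pose s := Num.sqrt (rss y fit / (\sum_(i < k.+1) n i)%:R).
  have s_gt0 : 0 < s by rewrite sqrtr_gt0 divr_gt0// ltr0n.
  exists fit, s; split=> // nu t nu_restricted t_gt0.
  rewrite !likelihoodE//; apply: profile_likelihood_le => //.
  by apply: le_trans (rss_sdmmsa_fit _ _ _ n_gt0 nu_restricted); rewrite lerDl sumr_ge0.
(* The maximality is used at the same sigma only, where the likelihoods are
   compared through their residual sums of squares. *)
- have rss_le : rss y mu <= rss y fit.
    have := mu_max fit sigma fit_restricted sigma_gt0.
    rewrite !likelihoodE// ler_pM2l ?exprn_gt0 ?normal_peak_gt0 ?gt_eqF//.
    by rewrite ler_expR ler_pM2r ?lerN2// invr_gt0 pmulrn_lgt0// exprn_gt0.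
  have dist0 : \sum_(i < k.+1) (n i)%:R * (fit i - mu i) ^+ 2 = 0.
    apply/eqP; rewrite eq_le sumr_ge0// andbT -(lerD2l (rss y fit)) addr0.
    exact: le_trans (rss_sdmmsa_fit _ _ _ n_gt0 mu_restricted) rss_le.
  have /(_ i isT)/eqP := psumr_eq0P (fun i _ => dist_ge0 mu i) dist0.
  rewrite mulf_eq0 sqrf_eq0 subr_eq0 pnatr_eq0 gtn_eqF//= => /eqP <-.
  by rewrite /fit /sdmmsa_fit -val_eqE /= gtn_eqF.
Qed.
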